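(* Let $(A,d_A)$ and $(H,d_H)$ be chain complexes and let $(p,i,h)$ be a contraction from $A$ to $H$. Suppose $(A,\mu_k,\alpha)$ is an $HA_\infty$-algebra with $\mu_1=d_A$ and $\alpha\circ h=h\circ\alpha$. Then $(H,d_H)$ inherits a structure of an $HA_\infty$-algebra; that is, there are maps $\mu_k^H:H^{\otimes k}\to H$ ($k\ge1$) of degree $k-2$ such that $(H,\mu_k^H,\alpha_H)$ is an $HA_\infty$-algebra with $\alpha_H=p\circ\alpha\circ i$, $\mu_1^H=d_H$ and $\mu_2^H(x,y)=p\,\mu_2(i(x),i(y))$ for $x,y\in H$.
   Context: All vector spaces are over a field of characteristic zero; the Koszul sign rule is used; the given map $\alpha:A\to A$ is assumed not identically zero. Differentials have degree $-1$. Contraction from $(A,d_A)$ to $(H,d_H)$: chain maps $p:A\to H$, $i:H\to A$ and a degree $+1$ linear map $h:A\to A$ with $1_A-i\circ p=d_Ah+hd_A$ and $p\circ i=1_H$. $HA_\infty$-algebra $(A,\mu_k,\alpha)$: a graded vector space $A$ with linear maps $\mu_k:A^{\otimes k}\to A$ of degree $k-2$ ($k\ge1$) and a degree $0$ linear map $\alpha$ with $\alpha\circ\mu_k=\mu_k\circ\alpha^{\otimes k}$, such that for all $n\ge1$ $$\sum_{r+s+t=n,\ r,t\ge0,\ s\ge1}(-1)^{rs+t}\,\mu_{r+1+t}\big((\alpha^{s-1})^{\otimes r}\otimes\mu_s\otimes(\alpha^{s-1})^{\otimes t}\big)=0 .$$ *)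

(* Defs.v *)
From HB Require Import structures.
From mathcomp Require Import all_boot all_order all_algebra.

Set Implicit Arguments.
Unset Strict Implicit.
Unset Printing Implicit Defensive.

Import GRing.Theory.

Local Open Scope ring_scope.

(* A Z-graded vector space, presented as its total space together with the
   family of its homogeneous components, of which it is the direct sum. *)
Record gradedSpace (K : fieldType) := GradedSpace {
  total :> lmodType K;
  homog : int -> total -> Prop;
  homog0 : forall n, homog n 0;
  homog_lin : forall n (a : K) (x y : total),
    homog n x -> homog n y -> homog n (a *: x + y);
  homog_span : forall x : total, exists (s : seq int) (f : int -> total),
    (forall n, homog n (f n)) /\ x = \sum_(n <- s) f n;
  homog_indep : forall (s : seq int) (f : int -> total),
    uniq s -> (forall n, homog n (f n)) -> \sum_(n <- s) f n = 0 ->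
    forall n, n \in s -> f n = 0
}.

Definition has_degree (K : fieldType) (A B : gradedSpace K) (m : int)
    (f : A -> B) : Prop :=
  forall n x, homog n x -> homog (n + m) (f x).

Fixpoint homogs (K : fieldType) (A : gradedSpace K) (ns : seq int)
    (xs : seq A) : Prop :=
  match ns, xs with
  | [::], [::] => True
  | n :: ns', x :: xs' => homog n x /\ homogs ns' xs'
  | _, _ => False
  end.

Record chain_complex (K : fieldType) (A : gradedSpace K)
    (d : {linear A -> A}) : Prop := ChainComplex {
  diff_degree : has_degree (-1) d;
  diff_sq : forall x, d (d x) = 0
}.

Record chain_map (K : fieldType) (A B : gradedSpace K)
    (dA : {linear A -> A}) (dB : {linear B -> B})
    (f : {linear A -> B}) : Prop := ChainMap {
  chain_map_degree : has_degree 0 f;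
  chain_map_comm : forall x, f (dA x) = dB (f x)
}.

Record contraction (K : fieldType) (A H : gradedSpace K)
    (dA : {linear A -> A}) (dH : {linear H -> H})
    (p : {linear A -> H}) (i : {linear H -> A}) (h : {linear A -> A}) : Prop :=
  Contraction {
  contr_p : chain_map dA dH p;
  contr_i : chain_map dH dA i;
  contr_h : has_degree 1 h;
  contr_homotopy : forall x, x - i (p x) = dA (h x) + h (dA x);
  contr_retract : forall y, p (i y) = y
}.

(* A family (mu_k) of k-ary operations on A, k >= 1, is encoded as a single
   function on sequences: mu [:: x_1; ...; x_k] is mu_k (x_1, ..., x_k).  The
   value mu [::] carries no meaning and is never constrained.  Linear maps out
   of the k-th tensor power are represented by k-linear maps. *)
Definition multilinear (K : fieldType) (A : gradedSpace K)
    (mu : seq A -> A) : Prop :=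
  forall (a : K) (us ws : seq A) (x y : A),
    mu (us ++ (a *: x + y) :: ws)
    = a *: mu (us ++ x :: ws) + mu (us ++ y :: ws).

(* The value at x_1 (x) ... (x) x_n, with x_j homogeneous of degree ns_j, of
     mu_(r+1+t) ((alpha^(s-1))^(x)r (x) mu_s (x) (alpha^(s-1))^(x)t),
   where t = n - r - s.  Moving mu_s, of degree s - 2, past x_1, ..., x_r
   yields the Koszul sign. *)
Definition HA_term (K : fieldType) (A : gradedSpace K) (mu : seq A -> A)
    (alpha : A -> A) (r s : nat) (ns : seq int) (xs : seq A) : A :=
  (-1 : K) ^ ((s%:Z - 2) * \sum_(n <- take r ns) n) *:
    mu (map (iter s.-1 alpha) (take r xs)
        ++ mu (take s (drop r xs))
        :: map (iter s.-1 alpha) (drop (r + s) xs)).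

Record HA_infinity (K : fieldType) (A : gradedSpace K) (mu : seq A -> A)
    (alpha : {linear A -> A}) : Prop := HAInfinity {
  HA_multilinear : multilinear mu;
  HA_degree : forall (ns : seq int) (xs : seq A),
    (0 < size xs)%N -> homogs ns xs ->
    homog (\sum_(n <- ns) n + (size xs)%:Z - 2) (mu xs);
  HA_alpha_degree : has_degree 0 alpha;
  HA_alpha_mu : forall xs : seq A,
    (0 < size xs)%N -> alpha (mu xs) = mu (map alpha xs);
  HA_relation : forall (n : nat) (ns : seq int) (xs : seq A),
    (0 < n)%N -> size xs = n -> homogs ns xs ->
    \sum_(0 <= r < n) \sum_(1 <= s < (n - r).+1)
      (-1 : K) ^+ (r * s + (n - r - s)) *: HA_term mu alpha r s ns xs = 0
}.

(* Main.v *)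
Require Import Defs.
From HB Require Import structures.
From mathcomp Require Import all_boot all_order all_algebra.
From mathcomp Require Import ring.
From Stdlib Require Import ClassicalEpsilon.

Set Implicit Arguments.
Unset Strict Implicit.
Unset Printing Implicit Defensive.

Import GRing.Theory.

Local Open Scope ring_scope.

(** Allowing formal negative powers of [alpha], the rescaled operations
    [alpha^-(k-1) mu_k], suspended, form an ordinary A-infinity algebra with
    operations [m].  The transferred structure is the usual sum over planar
    trees: with
      I = i - h psi,   psi = sum_(k >= 2) m_k (I (x) ... (x) I),
      nu = dH + p psi,
    both the defect of [I : (H, nu) -> (A, m)] being a morphism and the square of [nu] factor
    through [dA psi + psi nu], by [h] and [p] respectively; by induction on the
    number of arguments the first defect vanishes on shorter words, and then
    the relations of [m] give [dA psi + psi nu = 0].  Since the operations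
    commute with [alpha], weights can be shifted between arguments, which brings
    the relations of [nu] back to the HA-infinity form. *)

(** Since [alpha] need not be invertible, its negative powers exist only as integer weights on
    letters, and computing in a localisation is replaced by the rule [slides]. Koszul signs depend
    on degrees, which a general element does not have; they are therefore expressed through linear
    parity involutions, so the transfer itself takes place over ungraded modules and degrees enter
    it only as commutation or anticommutation with parity. The tensor coalgebra is not constructed:
    its coderivations and morphisms become lists of words ([ins], [wds]), and identities between
    them become equalities of sums of a multilinear [f] over such lists. Finally, [alpha] descends
    to H because i p = 1 - (dA h + h dA), where [alpha] commutes with [h] by assumption and with
    [dA] = mu_1; so it commutes with i p, and [i] and [p] intertwine it with p alpha i. *)

Fixpoint pre (T : Type) (w : seq T) : seq (seq T * seq T) :=
  if w is x :: w' then ([:: x], w') :: [seq (x :: q.1, q.2) | q <- pre w']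
  else [::].

Fixpoint comps (T : Type) (w : seq T) : seq (seq (seq T)) :=
  if w is x :: w' then
    [seq [:: x] :: c | c <- comps w'] ++
    [seq (x :: head [::] c) :: behead c | c <- comps w' & ~~ nilp c]
  else [:: [::]].

(** * Deconcatenation and block decompositions of words *)

Section Splittings.
Variables (T : Type) (M : zmodType).
Implicit Types (w u v : seq T) (g : seq T -> seq T -> M).

Lemma big_pre_cons g x w :
  \sum_(q <- pre (x :: w)) g q.1 q.2
  = g [:: x] w + \sum_(q <- pre w) g (x :: q.1) q.2.
Proof. by rewrite /= big_cons big_map. Qed.

(** [T] has no decidable equality, so the constraint [u ++ v = w] is supplied here instead of by
    list membership. *)
Lemma eq_big_pre g1 g2 w :
    (forall u v, u ++ v = w -> ~~ nilp u -> g1 u v = g2 u v) ->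
  \sum_(q <- pre w) g1 q.1 q.2 = \sum_(q <- pre w) g2 q.1 q.2.
Proof.
elim: w g1 g2 => [|x w IHw] g1 g2 eg; first by rewrite !big_nil.
rewrite !big_pre_cons eg //; congr (_ + _).
apply: (IHw (fun u => g1 (x :: u)) (fun u => g2 (x :: u))) => u v uv _.
by apply: eg; rewrite //= uv.
Qed.

(** Coassociativity of deconcatenation. The middle factor may be empty while [pre] excludes empty
    prefixes, which is why that case is a separate term on the right. *)
Lemma big_pre_coassoc (G : seq T -> seq T -> seq T -> M) w :
  \sum_(q <- pre w) \sum_(r <- pre q.1) G r.1 r.2 q.2
  = \sum_(q <- pre w) (G q.1 [::] q.2 + \sum_(r <- pre q.2) G q.1 r.1 r.2).
Proof.
elim: w G => [|x w IHw] G; first by rewrite !big_nil.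
rewrite (big_pre_cons (fun u v => \sum_(r <- pre u) G r.1 r.2 v)).
rewrite (big_pre_cons (fun u v => G u [::] v + \sum_(r <- pre v) G u r.1 r.2)).
rewrite (big_pre_cons (fun a b => G a b w)) big_nil addr0.
under eq_bigr => q _ do rewrite (big_pre_cons (fun a b => G a b q.2)).
by rewrite big_split /= (IHw (fun a => G (x :: a))) addrA.
Qed.

Lemma big_pre_cat g u v :
  \sum_(q <- pre (u ++ v)) g q.1 q.2
  = \sum_(q <- pre u) g q.1 (q.2 ++ v) + \sum_(q <- pre v) g (u ++ q.1) q.2.
Proof.
elim: u g => [|x u IHu] g; first by rewrite big_nil add0r.
rewrite cat_cons !(big_pre_cons g) (big_pre_cons (fun a b => g a (b ++ v))).
by rewrite (IHu (fun a => g (x :: a))) addrA.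
Qed.

Lemma big_pre_full (g : seq T -> M) w : ~~ nilp w ->
  \sum_(q <- pre w) (if nilp q.2 then g q.1 else 0) = g w.
Proof.
elim: w g => // x w IHw g _.
rewrite (big_pre_cons (fun a b => if nilp b then g a else 0)).
case: w IHw => [|y w] IHw; first by rewrite big_nil addr0.
by rewrite add0r (IHw (fun a => g (x :: a))).
Qed.

(** Trades the letter-by-letter recursion of [comps] for recursion on the first block, the form that
    later inductions follow. *)
Lemma big_comps (f : seq (seq T) -> M) w : ~~ nilp w ->
  \sum_(c <- comps w) f c
  = \sum_(q <- pre w) \sum_(c <- comps q.2) f (q.1 :: c).
Proof.
elim: w f => // x w IHw f _.
rewrite (big_pre_cons (fun u v => \sum_(c <- comps v) f (u :: c))) /=.
rewrite big_cat !big_map big_filter; congr (_ + _).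
case: w IHw => [|y w] IHw; first by rewrite big_cons !big_nil.
rewrite big_mkcond /= (IHw _ isT); apply: eq_bigr => q _; exact: eq_bigr.
Qed.

End Splittings.

Lemma comps_map (T U : Type) (g : T -> U) (w : seq T) :
  comps (map g w) = map (map (map g)) (comps w).
Proof.
elim: w => //= x w ->; rewrite map_cat filter_map -!map_comp.
congr (_ ++ _).
under eq_filter => c do rewrite /= /nilp size_map.
by apply: eq_map => -[|a c].
Qed.

Lemma big_pre_map (T U : Type) (M : zmodType) (h : T -> U)
    (F : seq U * seq U -> M) (w : seq T) :
  \sum_(q <- pre (map h w)) F q = \sum_(q <- pre w) F (map h q.1, map h q.2).
Proof.
have -> : pre (map h w) = [seq (map h q.1, map h q.2) | q <- pre w].
  by elim: w => //= x w ->; rewrite -!map_comp.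
by rewrite big_map.
Qed.

(* A letter [(x, a)] stands for the formal element [alpha^-a x]; the value of an
   operation on a word [w] carries the weight [wt w], [alpha^-(k-1)] being the
   factor by which the [k]-ary operation is rescaled. *)
Definition letters (V : Type) := seq (V * nat).

Definition wt (V : Type) (w : letters V) : nat :=
  (sumn [seq l.2.+1 | l <- w]).-1.

Definition lmap (U V : Type) (g : U -> V) (l : U * nat) : V * nat :=
  (g l.1, l.2).

Definition sing (U : Type) (V : zmodType) (g : U -> V) (w : letters U) : V :=
  if w is [:: l] then g l.1 else 0.

(** Terms of the morphism of tensor coalgebras with corestriction [J]. No sign occurs because after
    suspension [J] is even. *)
Definition wds (U V : Type) (J : letters U -> V) (w : letters U) :
    seq (letters V) :=
  [seq [seq (J u, wt u) | u <- c] | c <- comps w].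

(* [tau] is the parity involution: applied to the letters to the left of the
   inserted value, it is the Koszul sign of moving the odd operation [f]. *)
Fixpoint ins (U : Type) (tau : U -> U) (f : letters U -> U) (w : letters U) :
    seq (letters U) :=
  if w is x :: w' then
    [seq (f q.1, wt q.1) :: q.2 | q <- pre w]
      ++ [seq lmap tau x :: v | v <- ins tau f w']
  else [::].

Lemma wt_map (U V : Type) (g : U -> V) (w : letters U) :
  wt (map (lmap g) w) = wt w.
Proof. by rewrite /wt -map_comp. Qed.

Lemma wt_cons (U : Type) (l : U * nat) (w : letters U) :
  wt (l :: w) = (l.2 + sumn [seq l.2.+1 | l <- w])%N.
Proof. by []. Qed.

(** Hence collapsing a nonempty block [u] to a letter of weight [wt u] preserves the sum of
    [l.2.+1], and nested operations carry the same total weight however they are bracketed. *)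
Lemma sumn_wt (U : Type) (w : letters U) : ~~ nilp w ->
  sumn [seq l.2.+1 | l <- w] = (wt w).+1.
Proof. by case: w => // l w _; rewrite wt_cons. Qed.

(** * Sums over block decompositions and over insertions *)

Section Words.
Variables (U V : Type) (M : zmodType) (J : letters U -> V).
Implicit Types (w u v : letters U) (f : letters V -> M).

Lemma big_wds_nil f : \sum_(W <- wds J [::]) f W = f [::].
Proof. by rewrite /wds big_map big_seq1. Qed.

Lemma big_wds f w : ~~ nilp w ->
  \sum_(W <- wds J w) f W
  = \sum_(q <- pre w) \sum_(W <- wds J q.2) f ((J q.1, wt q.1) :: W).
Proof.
move=> nw; rewrite big_map big_comps //.
by apply: eq_bigr => q _; rewrite big_map.
Qed.

Lemma big_ins (tau : U -> U) (nu : letters U -> U) (f : letters U -> M) x w :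
  \sum_(W <- ins tau nu (x :: w)) f W
  = \sum_(q <- pre (x :: w)) f ((nu q.1, wt q.1) :: q.2)
    + \sum_(W <- ins tau nu w) f (lmap tau x :: W).
Proof.
have -> : ins tau nu (x :: w)
    = [seq (nu q.1, wt q.1) :: q.2 | q <- pre (x :: w)]
        ++ [seq lmap tau x :: v | v <- ins tau nu w] by [].
by rewrite big_cat !big_map.
Qed.

(** Membership in [wds J w] is replaced by two invariants of collapsing blocks: nonemptiness and
    total weight. *)
Lemma eq_big_wds f g w :
  (forall W, (~~ nilp w -> ~~ nilp W) ->
     sumn [seq l.2.+1 | l <- W] = sumn [seq l.2.+1 | l <- w] -> f W = g W) ->
  \sum_(W <- wds J w) f W = \sum_(W <- wds J w) g W.
Proof.
have [n] := ubnP (size w); elim: n w f g => // n IHn [|x w] f g.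
  by move=> _ e; rewrite !big_wds_nil; apply: e.
rewrite ltnS => szw e; rewrite !big_wds //.
apply: (eq_big_pre
  (g1 := fun u v => \sum_(W <- wds J v) f ((J u, wt u) :: W))
  (g2 := fun u v => \sum_(W <- wds J v) g ((J u, wt u) :: W))).
move=> [|y u] v // Duv nu; apply: IHn.
  by apply: leq_trans szw; rewrite -Duv size_cat /= addSn ltnS leq_addl.
move=> W _ DW; apply: e => //.
by rewrite -Duv map_cat sumn_cat -DW [in RHS]sumn_wt.
Qed.

Lemma eq_big_ins (tau : U -> U) (nu : letters U -> U) (f g : letters U -> M) w :
  (forall W, ~~ nilp W ->
     sumn [seq l.2.+1 | l <- W] = sumn [seq l.2.+1 | l <- w] -> f W = g W) ->
  \sum_(W <- ins tau nu w) f W = \sum_(W <- ins tau nu w) g W.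
Proof.
elim: w f g => [|x w IHw] f g e; first by rewrite !big_nil.
rewrite !big_ins; congr (_ + _).
  apply: (eq_big_pre (g1 := fun u v => f ((nu u, wt u) :: v))
                     (g2 := fun u v => g ((nu u, wt u) :: v))).
  move=> u v Duv nu0; apply: e => //.
  by rewrite -Duv map_cat sumn_cat [in RHS]sumn_wt.
by apply: IHw => W _ DW; apply: e; rewrite //= DW.
Qed.

End Words.
Arguments eq_big_wds {U V M J} f g w.
Arguments eq_big_ins {U M tau nu} f g w.

Section Leibniz.
Variables (U : Type) (M : zmodType) (tau : U -> U) (nu : letters U -> U).

(** [ins] is a coderivation: the inserted value lies in one factor of the splitting, and if it lies
    in the right one, the operation has passed the left factor, hence [tau] there. Insertions
    starting at the first letter are matched by coassociativity. *)
Lemma big_ins_pre (g : letters U -> letters U -> M) w :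
  \sum_(W <- ins tau nu w) \sum_(q <- pre W) g q.1 q.2
  = \sum_(q <- pre w) (\sum_(u <- ins tau nu q.1) g u q.2
      + \sum_(v <- ins tau nu q.2) g (map (lmap tau) q.1) v).
Proof.
elim: w g => [|x w IHw] g; first by rewrite !big_nil.
have e1 : \sum_(q <- pre (x :: w)) \sum_(u <- ins tau nu q.1) g u q.2
    = \sum_(q <- pre (x :: w)) (g [:: (nu q.1, wt q.1)] q.2
        + \sum_(r <- pre q.2) g ((nu q.1, wt q.1) :: r.1) r.2)
      + \sum_(q <- pre w) \sum_(u <- ins tau nu q.1) g (lmap tau x :: u) q.2.
  rewrite -(big_pre_coassoc (fun a b c => g ((nu a, wt a) :: b) c)).
  rewrite (big_pre_cons (fun a c => \sum_(u <- ins tau nu a) g u c)).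
  under [X in _ + X = _]eq_bigr => q _ do rewrite big_ins.
  rewrite big_ins big_nil addr0 [X in _ + X = _]big_split /= addrA.
  congr (_ + _).
  by rewrite -(big_pre_cons
    (fun a c => \sum_(r <- pre a) g ((nu r.1, wt r.1) :: r.2) c)).
have -> : forall F G : seq (U * nat) * seq (U * nat) -> M,
    \sum_(q <- pre (x :: w)) (F q + G q)
    = \sum_(q <- pre (x :: w)) F q + \sum_(q <- pre (x :: w)) G q.
  by move=> F G; exact: big_split.
rewrite big_ins e1 -!addrA; congr (_ + _).
  by apply: eq_bigr => q _; rewrite big_pre_cons.
rewrite (big_pre_cons
  (fun a c => \sum_(v <- ins tau nu c) g (map (lmap tau) a) v)).
under eq_bigr => W _ do rewrite big_pre_cons.
rewrite big_split /= (IHw (fun a => g (lmap tau x :: a))) big_split /=.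
by rewrite addrCA.
Qed.

End Leibniz.

(** Compatibility of a coalgebra morphism with the coproduct: a splitting of the collapsed word
    comes from a splitting of [w] between two blocks. *)
Lemma big_wds_pre (U V : Type) (M : zmodType) (J : letters U -> V)
    (g : letters V -> letters V -> M) w :
  \sum_(W <- wds J w) \sum_(q <- pre W) g q.1 q.2
  = \sum_(q <- pre w) \sum_(u <- wds J q.1) \sum_(v <- wds J q.2) g u v.
Proof.
have [n] := ubnP (size w); elim: n w g => // n IHn [|x w] g.
  by move=> _; rewrite big_wds_nil !big_nil.
rewrite ltnS => szw; rewrite big_wds //.
pose G u u' v := \sum_(U' <- wds J u') \sum_(V' <- wds J v)
  g ((J u, wt u) :: U') V'.
transitivity (\sum_(q <- pre (x :: w)) (G q.1 [::] q.2
    + \sum_(r <- pre q.2) G q.1 r.1 r.2)); last first.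
  rewrite -(big_pre_coassoc G).
  apply: (eq_big_pre (g1 := fun u v => \sum_(r <- pre u) G r.1 r.2 v)
    (g2 := fun u v => \sum_(U' <- wds J u) \sum_(V' <- wds J v) g U' V')).
  by move=> u v _ nu; rewrite [RHS]big_wds.
apply: (eq_big_pre
  (g1 := fun u v => \sum_(W <- wds J v) \sum_(q <- pre ((J u, wt u) :: W))
            g q.1 q.2)
  (g2 := fun u v => G u [::] v + \sum_(r <- pre v) G u r.1 r.2)).
move=> [|y u] v // Duv _.
under eq_bigr => W _ do rewrite big_pre_cons.
rewrite big_split {1}/G big_wds_nil; congr (_ + _).
rewrite (IHn v (fun a => g ((J (y :: u), wt (y :: u)) :: a))) //.
by apply: leq_trans szw; rewrite -Duv size_cat /= addSn ltnS leq_addl.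
Qed.

Section Multilinear.
Variables (K : fieldType) (V M : lmodType K).
Implicit Types (u w : letters V) (f : letters V -> M).

Definition mlin f := forall (a : K) u w x y c,
  f (u ++ (a *: x + y, c) :: w)
  = a *: f (u ++ (x, c) :: w) + f (u ++ (y, c) :: w).

Lemma mlin_cat f u : mlin f -> mlin (fun w => f (u ++ w)).
Proof. by move=> fl a u' w x y c; rewrite !catA fl. Qed.

Lemma mlin_cons f l : mlin f -> mlin (fun w => f (l :: w)).
Proof. exact: (@mlin_cat f [:: l]). Qed.

Lemma mlin0 f u w c : mlin f -> f (u ++ (0, c) :: w) = 0.
Proof.
move=> fl; have := fl 1 u w 0 0 c; rewrite !scale1r addr0.
by move/(congr1 (fun z => z - f (u ++ (0, c) :: w))); rewrite subrr addrK.
Qed.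

Lemma mlinD f u w c x y : mlin f ->
  f (u ++ (x + y, c) :: w) = f (u ++ (x, c) :: w) + f (u ++ (y, c) :: w).
Proof. by move=> fl; rewrite -[x]scale1r fl !scale1r. Qed.

Lemma mlin_sum f u w c (T : Type) (s : seq T) (F : T -> V) : mlin f ->
  f (u ++ (\sum_(t <- s) F t, c) :: w) = \sum_(t <- s) f (u ++ (F t, c) :: w).
Proof.
move=> fl; elim: s => [|t s IHs]; first by rewrite !big_nil mlin0.
by rewrite !big_cons mlinD // IHs.
Qed.

End Multilinear.

(** * Transfer of operations *)

Section Interchange.
Variables (K : fieldType) (U V M : lmodType K).
Variables (tU : U -> U) (tV : V -> V) (J : letters U -> V).
Variables (m : letters V -> V) (nu : letters U -> U).
Hypothesis Jt : forall w, J (map (lmap tU) w) = tV (J w).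
Implicit Types (w : letters U) (f : letters V -> M).

Lemma big_ins_wds f w : mlin f -> ~~ nilp w ->
  \sum_(X <- ins tU nu w) \sum_(W <- wds J X) f W
  = \sum_(q <- pre w)
      (\sum_(W <- wds J q.2) f ((\sum_(X <- ins tU nu q.1) J X, wt q.1) :: W)
       + \sum_(X <- ins tU nu q.2) \sum_(W <- wds J X)
           f ((tV (J q.1), wt q.1) :: W)).
Proof.
move=> fl nw.
pose g u v := \sum_(W <- wds J v) f ((J u, wt u) :: W).
transitivity (\sum_(X <- ins tU nu w) \sum_(q <- pre X) g q.1 q.2).
  by apply: eq_big_ins => X nX _; rewrite big_wds.
rewrite big_ins_pre; apply: eq_bigr => q _; congr (_ + _); last first.
  by apply: eq_bigr => X _; rewrite /g Jt wt_map.
rewrite exchange_big; apply: eq_bigr => W _.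
rewrite (mlin_sum [::]) //; apply: eq_big_ins => X _ eX.
by rewrite /= /wt eX.
Qed.

Lemma big_wds_ins f w : mlin f -> ~~ nilp w ->
  \sum_(W <- wds J w) \sum_(X <- ins tV m W) f X
  = \sum_(q <- pre w)
      (\sum_(W <- wds J q.2) f ((\sum_(X <- wds J q.1) m X, wt q.1) :: W)
       + \sum_(W <- wds J q.2) \sum_(X <- ins tV m W)
           f ((tV (J q.1), wt q.1) :: X)).
Proof.
move=> fl nw.
transitivity (\sum_(W <- wds J w) (\sum_(q <- pre W) f ((m q.1, wt q.1) :: q.2)
    + \sum_(X <- ins tV m (behead W)) f (lmap tV (head (0, 0%N) W) :: X))).
  apply: eq_big_wds => -[|l W] nW _; first by have := nW nw.
  by rewrite big_ins.
rewrite big_split /= (big_wds_pre J (fun a b => f ((m a, wt a) :: b))).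
rewrite [X in _ + X](big_wds J) // [RHS]big_split /=; congr (_ + _).
apply: eq_bigr => q _; rewrite exchange_big; apply: eq_bigr => W _.
rewrite (mlin_sum [::]) //; apply: eq_big_wds => X _ eX.
by rewrite /= /wt eX.
Qed.

(** Both sides come from coderivations along [wds J], so they agree once their one-letter components
    do. That agreement is assumed only for words shorter than [n]: a block of length [n] is the
    whole word and leaves a single letter, where [f] vanishes. *)
Lemma ins_wds_comm n f w : mlin f -> (size w <= n)%N ->
    (size w < n)%N \/ (forall l, f [:: l] = 0) ->
    (forall u, ~~ nilp u -> (size u < n)%N ->
       \sum_(X <- ins tU nu u) J X = \sum_(W <- wds J u) m W) ->
  \sum_(X <- ins tU nu w) \sum_(W <- wds J X) f W
  = \sum_(W <- wds J w) \sum_(X <- ins tV m W) f X.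
Proof.
have [k] := ubnP (size w); elim: k w f => // k IHk [|x w] f.
  by rewrite big_nil big_wds_nil big_nil.
rewrite ltnS => szk fl szn lt_n eqn.
rewrite big_ins_wds // big_wds_ins //.
apply: (eq_big_pre
  (g1 := fun u v =>
     \sum_(W <- wds J v) f ((\sum_(X <- ins tU nu u) J X, wt u) :: W)
       + \sum_(X <- ins tU nu v) \sum_(W <- wds J X) f ((tV (J u), wt u) :: W))
  (g2 := fun u v =>
     \sum_(W <- wds J v) f ((\sum_(X <- wds J u) m X, wt u) :: W)
       + \sum_(W <- wds J v) \sum_(X <- ins tV m W)
           f ((tV (J u), wt u) :: X))).
move=> [|y u] v // Duv _.
have sz : size (x :: w) = (size u + size v).+1 by rewrite -Duv /= size_cat.
have ltv : (size v < size (x :: w))%N by rewrite sz ltnS leq_addl.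
congr (_ + _); last first.
  apply: IHk => //; first exact: leq_trans ltv szk.
  - exact: mlin_cons.
  - exact: ltnW (leq_trans ltv szn).
  - by left; apply: leq_trans ltv szn.
have [lt_u | ge_u] := ltnP (size (y :: u)) n; first by rewrite eqn.
have v0 : size v = 0%N.
  apply/eqP; rewrite -leqn0 -(leq_add2l (size u).+1) addn0 addSn -sz.
  exact: leq_trans szn ge_u.
have f0 l : f [:: l] = 0.
  case: lt_n => [lt_n | -> //]; have := leq_trans lt_n ge_u.
  by rewrite sz v0 addn0 ltnn.
by rewrite (size0nil v0) !big_wds_nil !f0.
Qed.

End Interchange.

(* The letter [(x, a.+1)] denotes [alpha^-1 (x, a)]; since operations commute
   with [alpha], the factor is moved to the other arguments as [alpha]. *)
Definition slides (V M : Type) (alpha : V -> V) (f g : letters V -> M) :=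
  forall u w x a, f (u ++ (x, a.+1) :: w)
    = g (map (lmap alpha) u ++ (x, a) :: map (lmap alpha) w).

(** * Linearity and sliding for sums over block decompositions *)

Section WdsLaws.
Variables (K : fieldType) (U V M : lmodType K).
Implicit Types (J : letters U -> V) (f g : letters V -> M).

Lemma wds_map J (a : U -> U) (b : V -> V) w :
    (forall u, J (map (lmap a) u) = b (J u)) ->
  wds J (map (lmap a) w) = map (map (lmap b)) (wds J w).
Proof.
move=> Jab; rewrite /wds comps_map -!map_comp; apply: eq_map => c /=.
by rewrite -!map_comp; apply: eq_map => u; rewrite /= /lmap Jab wt_map.
Qed.

(** Classifies the first block by whether it stops before [z], at [z] or after [z]. Only the first
    case leaves [z] untouched, and there induction on [u] applies. *)
Lemma big_wds_cat J f u z w :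
  \sum_(W <- wds J (u ++ z :: w)) f W
  = \sum_(q <- pre u)
      \sum_(W <- wds J (q.2 ++ z :: w)) f ((J q.1, wt q.1) :: W)
    + (\sum_(W <- wds J w) f ((J (u ++ [:: z]), wt (u ++ [:: z])) :: W)
       + \sum_(q <- pre w) \sum_(W <- wds J q.2)
           f ((J (u ++ z :: q.1), wt (u ++ z :: q.1)) :: W)).
Proof.
rewrite big_wds; last by case: u.
rewrite (big_pre_cat (fun a b => \sum_(W <- wds J b) f ((J a, wt a) :: W))).
by rewrite (big_pre_cons
  (fun a b => \sum_(W <- wds J b) f ((J (u ++ a), wt (u ++ a)) :: W))).
Qed.

(** The same cut-off as in [ins_wds_comm]; it is what makes surplus fuel in [kernel_rec]
    immaterial. *)
Lemma eq_wds J J' n f w : (size w <= n)%N ->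
    (size w < n)%N \/ (forall l, f [:: l] = 0) ->
    (forall u, ~~ nilp u -> (size u < n)%N -> J u = J' u) ->
  \sum_(W <- wds J w) f W = \sum_(W <- wds J' w) f W.
Proof.
have [k] := ubnP (size w); elim: k w f => // k IHk [|x w] f.
  by rewrite !big_wds_nil.
rewrite ltnS => szk szn lt_n eqJ; rewrite !big_wds //.
apply: (eq_big_pre
  (g1 := fun u v => \sum_(W <- wds J v) f ((J u, wt u) :: W))
  (g2 := fun u v => \sum_(W <- wds J' v) f ((J' u, wt u) :: W))).
move=> [|y u] v // Duv _.
have sz : size (x :: w) = (size u + size v).+1 by rewrite -Duv /= size_cat.
have ltv : (size v < size (x :: w))%N by rewrite sz ltnS leq_addl.
rewrite (IHk v); first last.
- exact: eqJ.
- by left; apply: leq_trans ltv szn.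
- exact: ltnW (leq_trans ltv szn).
- exact: leq_trans ltv szk.
have [lt_u | ge_u] := ltnP (size (y :: u)) n; first by rewrite eqJ.
have v0 : size v = 0%N.
  apply/eqP; rewrite -leqn0 -(leq_add2l (size u).+1) addn0 addSn -sz.
  exact: leq_trans szn ge_u.
have f0 l : f [:: l] = 0.
  case: lt_n => [lt_n | -> //]; have := leq_trans lt_n ge_u.
  by rewrite sz v0 addn0 ltnn.
by rewrite (size0nil v0) !big_wds_nil !f0.
Qed.

Lemma mlin_wds J f : mlin J -> mlin f ->
  mlin (fun w => \sum_(W <- wds J w) f W).
Proof.
move=> Jl fl a u w x y c.
have [n] := ubnP (size u); elim: n u f fl => // n IHn u f fl.
rewrite ltnS => szu; rewrite !big_wds_cat !scalerDr !scaler_sumr.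
rewrite addrACA -big_split; congr (_ + _).
  apply: (eq_big_pre
    (g1 := fun s t => \sum_(W <- wds J (t ++ (a *: x + y, c) :: w))
       f ((J s, wt s) :: W))
    (g2 := fun s t => a *: (\sum_(W <- wds J (t ++ (x, c) :: w))
       f ((J s, wt s) :: W)) + \sum_(W <- wds J (t ++ (y, c) :: w))
       f ((J s, wt s) :: W))).
  move=> [|z s] t // Du _; apply: IHn; first exact: mlin_cons.
  by apply: leq_trans szu; rewrite -Du size_cat /= addSn ltnS leq_addl.
have wtE s z : wt (u ++ (z, c) :: s) = wt (u ++ (0, c) :: s).
  by rewrite /wt !map_cat.
have step W s :
  f ((J (u ++ (a *: x + y, c) :: s), wt (u ++ (a *: x + y, c) :: s)) :: W)
  = a *: f ((J (u ++ (x, c) :: s), wt (u ++ (x, c) :: s)) :: W)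
    + f ((J (u ++ (y, c) :: s), wt (u ++ (y, c) :: s)) :: W).
  by rewrite !wtE Jl (fl a [::]).
rewrite addrACA -big_split -big_split /=; congr (_ + _); apply: eq_bigr => q _.
  by rewrite step.
rewrite scaler_sumr -big_split; apply: eq_bigr => W _; exact: step.
Qed.

Lemma slides_wds J f g (aU : U -> U) (aV : V -> V) :
    (forall u, J (map (lmap aU) u) = aV (J u)) ->
    slides aU J J -> slides aV f g ->
  slides aU (fun w => \sum_(W <- wds J w) f W) (fun w => \sum_(W <- wds J w) g W).
Proof.
move=> Ja Js fs u w x a.
have [n] := ubnP (size u); elim: n u f g fs => // n IHn u f g fs.
rewrite ltnS => szu; rewrite !big_wds_cat.
rewrite !(big_pre_map (lmap aU)) /=; congr (_ + _).
  apply: (eq_big_pre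
    (g1 := fun s t => \sum_(W <- wds J (t ++ (x, a.+1) :: w))
       f ((J s, wt s) :: W))
    (g2 := fun s t => \sum_(W <- wds J (map (lmap aU) t
       ++ (x, a) :: map (lmap aU) w))
       g ((J (map (lmap aU) s), wt (map (lmap aU) s)) :: W))).
  move=> [|z s] t // Du _; apply: IHn.
    by move=> u' w' x' a'; rewrite Ja wt_map -!cat_cons fs.
  by apply: leq_trans szu; rewrite -Du size_cat /= addSn ltnS leq_addl.
(* The block containing the letter loses one unit of weight along with it, so the decrement passes
   to the collapsed word, where [fs] applies. *)
have wtS s : wt (u ++ (x, a.+1) :: s)
    = (wt (map (lmap aU) u ++ (x, a) :: map (lmap aU) s)).+1.
  rewrite /wt !map_cat /= !sumn_cat /= addnS /= -[in RHS]map_comp.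
  by rewrite -map_comp addSn addnS.
have step W s : f ((J (u ++ (x, a.+1) :: s), wt (u ++ (x, a.+1) :: s)) :: W)
  = g ((J (map (lmap aU) u ++ (x, a) :: map (lmap aU) s),
        wt (map (lmap aU) u ++ (x, a) :: map (lmap aU) s))
        :: map (lmap aV) W).
  by rewrite wtS Js (fs [::]).
congr (_ + _).
  rewrite (wds_map _ Ja) [RHS]big_map; apply: eq_bigr => W _; exact: (step W [::]).
apply: eq_bigr => q _; rewrite (wds_map _ Ja) [RHS]big_map; apply: eq_bigr => W _.
exact: step.
Qed.

End WdsLaws.

(** * The recursive sum over trees and its relations, without gradings *)

Section Transfer.
Variables (K : fieldType) (A H : lmodType K).
Variables (tA alA dA h : {linear A -> A}) (tH alH dH : {linear H -> H}).
Variables (p : {linear A -> H}) (i : {linear H -> A}) (m : letters A -> A).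

Definition m2 (w : letters A) : A := if w is _ :: _ :: _ then m w else 0.

(* The fuel [size w] suffices: [m2] vanishes on one-letter words, so only
   decompositions of [w] into strictly shorter blocks contribute. *)
Fixpoint kernel_rec (n : nat) (w : letters H) : A :=
  if n is n'.+1 then sing i w - h (\sum_(W <- wds (kernel_rec n') w) m2 W) else 0.

(** [kernel], [kernel_root] and [transferred] are the I, psi and nu of the overview. *)
Definition kernel w := kernel_rec (size w) w.

Definition kernel_root w := \sum_(W <- wds kernel w) m2 W.

Definition transferred w := sing dH w + p (kernel_root w).

Lemma kernel_rec_fuel n w : (size w <= n)%N -> kernel_rec n w = kernel w.
Proof.
move=> szn; rewrite /kernel.
suff fuel k : (size w <= k)%N -> kernel_rec n w = kernel_rec k w by exact: fuel.
elim: n k w szn => [|n IHn] [|k] [|l w] //= szn szk;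
  rewrite ?big_wds_nil ?linear0 ?oppr0 ?addr0 //.
congr (_ - h _); apply: (@eq_wds _ _ _ _ _ _ (size w).+1) => //; first by right.
move=> u _ ltu; apply: IHn; rewrite -ltnS; first exact: leq_trans ltu szn.
exact: leq_trans ltu szk.
Qed.

Lemma kernelE w : kernel w = sing i w - h (kernel_root w).
Proof.
(* After one unfolding, fuel [size w] is left over, enough for every block of [w], including [w]
   itself. *)
rewrite -(kernel_rec_fuel (leqnSn (size w))) /=; congr (_ - h _).
apply: (@eq_wds _ _ _ _ _ _ (size w).+1) => // [|u _]; first by left.
exact: kernel_rec_fuel.
Qed.

Hypothesis m_lin : mlin m.
Hypothesis m_slides : slides alA m m.
Hypothesis m_al : forall w, ~~ nilp w -> m (map (lmap alA) w) = alA (m w).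
Hypothesis m_t : forall w, ~~ nilp w -> m (map (lmap tA) w) = - tA (m w).
Hypothesis m_1 : forall l, m [:: l] = dA l.1.
Hypothesis m_rel : forall w, ~~ nilp w -> \sum_(V <- ins tA m w) m V = 0.

Hypothesis i_t : forall y, i (tH y) = tA (i y).
Hypothesis h_t : forall x, h (tA x) = - tA (h x).
Hypothesis i_al : forall y, i (alH y) = alA (i y).
Hypothesis p_al : forall x, p (alA x) = alH (p x).
Hypothesis h_al : forall x, h (alA x) = alA (h x).
Hypothesis dH_al : forall y, dH (alH y) = alH (dH y).

Hypothesis dH_sq : forall y, dH (dH y) = 0.
Hypothesis i_d : forall y, dA (i y) = i (dH y).
Hypothesis p_d : forall x, p (dA x) = dH (p x).
Hypothesis homotopy : forall x, x - i (p x) = dA (h x) + h (dA x).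

Lemma sing_lin (V W : lmodType K) (f : {linear V -> W}) : mlin (sing f).
Proof.
move=> a [|l [|l' u]] [|l'' w] x y c; rewrite /= ?scaler0 ?addr0 //.
exact: linearP.
Qed.

Lemma sing_slides (V W : lmodType K) (f : V -> W) (al : V -> V) :
  slides al (sing f) (sing f).
Proof. by case=> [|l [|l' u]] [|l'' w]. Qed.

Lemma sing_map (V W : lmodType K) (f : V -> W) (a : V -> V) (b : {linear W -> W}) w :
  (forall y, f (a y) = b (f y)) -> sing f (map (lmap a) w) = b (sing f w).
Proof. by move=> fab; case: w => [|l [|l' w]] //=; rewrite linear0. Qed.

Lemma m2_lin : mlin m2.
Proof.
by move=> a [|l [|l' u]] [|l'' w] x y c; rewrite /= ?scaler0 ?addr0 //;
  [exact: (m_lin a [::])|exact: (m_lin a [:: l])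
  |exact: (m_lin a [:: l])|exact: (m_lin a [:: l, l' & u])
  |exact: (m_lin a [:: l, l' & u])].
Qed.

Lemma m2_slides : slides alA m2 m2.
Proof.
by case=> [|l [|l' u]] [|l'' w] x a //=;
  [exact: (m_slides [::])|exact: (m_slides [:: l])
  |exact: (m_slides [:: l])|exact: (m_slides [:: l, l' & u])
  |exact: (m_slides [:: l, l' & u])].
Qed.

Lemma m2_al w : m2 (map (lmap alA) w) = alA (m2 w).
Proof. case: w => [|l [|l' w]]; rewrite ?linear0 //; exact: m_al. Qed.

Lemma m2_t w : m2 (map (lmap tA) w) = - tA (m2 w).
Proof. case: w => [|l [|l' w]]; rewrite ?linear0 ?oppr0 //; exact: m_t. Qed.

Lemma mE w : ~~ nilp w -> m w = sing dA w + m2 w.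
Proof. by case: w => [|l [|l' w]] //= _; rewrite ?addr0 ?add0r. Qed.

(** The scalar lets one proof serve [alpha] ([e] = 1) and parity ([e] = -1); in the second case the
    signs of the odd maps [m2] and [h] cancel. *)
Lemma kernel_rec_map n w (a : {linear H -> H}) (b : {linear A -> A}) (e : K) :
    (forall y, i (a y) = b (i y)) -> (forall x, h (e *: b x) = b (h x)) ->
    (forall w, m2 (map (lmap b) w) = e *: b (m2 w)) ->
  kernel_rec n (map (lmap a) w) = b (kernel_rec n w).
Proof.
move=> iab hb mb; elim: n w => [|n IHn] w /=; first by rewrite linear0.
rewrite (sing_map _ iab) linearB /=; congr (_ - _).
rewrite (wds_map _ IHn) -hb; congr (h _).
rewrite linear_sum scaler_sumr big_map; apply: eq_bigr => W _; exact: mb.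
Qed.

Lemma kernel_map w (a : {linear H -> H}) (b : {linear A -> A}) (e : K) :
    (forall y, i (a y) = b (i y)) -> (forall x, h (e *: b x) = b (h x)) ->
    (forall w, m2 (map (lmap b) w) = e *: b (m2 w)) ->
  kernel (map (lmap a) w) = b (kernel w).
Proof. by move=> *; rewrite /kernel size_map; apply: kernel_rec_map. Qed.

Lemma kernel_t w : kernel (map (lmap tH) w) = tA (kernel w).
Proof.
apply: (@kernel_map _ tH tA (-1)) => // [x|W].
  by rewrite scaleN1r linearN h_t opprK.
by rewrite m2_t scaleN1r.
Qed.

Lemma kernel_al w : kernel (map (lmap alH) w) = alA (kernel w).
Proof.
by apply: (@kernel_map _ alH alA 1) => // [x|W]; rewrite scale1r // m2_al.
Qed.

Lemma kernel_rec_lin n : mlin (kernel_rec n).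
Proof.
elim: n => [|n IHn] a u w x y c; first by rewrite /= scaler0 addr0.
rewrite /= (sing_lin i) (mlin_wds IHn m2_lin) linearP /=.
by rewrite opprD addrACA -scalerBr.
Qed.

Lemma kernel_lin : mlin kernel.
Proof. by move=> a u w x y c; rewrite /kernel !size_cat /= kernel_rec_lin. Qed.

Lemma kernel_rec_slides n : slides alH (kernel_rec n) (kernel_rec n).
Proof.
elim: n => [|n IHn] u w x a //=; rewrite (sing_slides _ alH); congr (_ - h _).
apply: slides_wds IHn m2_slides u w x a => u.
apply: (@kernel_rec_map _ _ alH alA 1) => // [z|W]; rewrite scale1r //.
exact: m2_al.
Qed.

Lemma kernel_slides : slides alH kernel kernel.
Proof.
by move=> u w x a; rewrite /kernel !size_cat /= !size_map kernel_rec_slides.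
Qed.

Lemma transferred_lin : mlin transferred.
Proof.
move=> a u w x y c; rewrite /transferred (sing_lin dH).
rewrite /kernel_root (mlin_wds kernel_lin m2_lin) linearP /=.
by rewrite addrACA -scalerDr.
Qed.

Lemma transferred_slides : slides alH transferred transferred.
Proof.
move=> u w x a; rewrite /transferred (sing_slides _ alH); congr (_ + p _).
exact: slides_wds kernel_al kernel_slides m2_slides u w x a.
Qed.

Lemma transferred_al w : transferred (map (lmap alH) w) = alH (transferred w).
Proof.
rewrite /transferred /kernel_root (sing_map _ dH_al) linearD /=; congr (_ + _).
rewrite (wds_map _ kernel_al) big_map.
by rewrite (eq_bigr _ (fun W _ => m2_al W)) -linear_sum p_al.
Qed.

(** [sing] sees only one-letter words, and these arise from the decomposition into a single
    block. *)
Lemma sum_sing_wds (f : {linear A -> A}) w : ~~ nilp w ->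
  \sum_(W <- wds kernel w) sing f W = f (kernel w).
Proof.
move=> nw; rewrite big_wds // -[RHS](big_pre_full (fun u => f (kernel u)) nw).
apply: eq_bigr => -[u [|x v]] _ /=; first by rewrite big_wds_nil.
by rewrite big_wds // big1 // => q _; rewrite big1.
Qed.

Lemma sum_sing_ins (V W : lmodType K) (t : V -> V) (g : letters V -> V)
    (f : {linear V -> W}) w : ~~ nilp w ->
  \sum_(X <- ins t g w) sing f X = f (g w).
Proof.
case: w => // x w _; rewrite big_ins.
rewrite [X in _ + X](eq_big_ins _ (fun=> 0)) => [|[|l X]] //.
rewrite [X in _ + X]big1 // addr0 -[RHS](big_pre_full (fun u => f (g u))) //.
by apply: eq_bigr => -[u [|y v]].
Qed.

Lemma dA_sq x : dA (dA x) = 0.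
Proof.
have := m_rel (w := [:: (x, 0%N)]) isT.
by rewrite /= big_cons big_nil addr0 !m_1.
Qed.

Lemma sum_m_wds w : ~~ nilp w ->
  \sum_(W <- wds kernel w) m W = dA (kernel w) + kernel_root w.
Proof.
move=> nw; rewrite (eq_big_wds _ (fun W => sing dA W + m2 W)); last first.
  by move=> W nW _; apply/mE/nW.
by rewrite big_split /= sum_sing_wds.
Qed.

(* Up to [h], respectively [p], the left-hand side is the failure of [kernel]
   to intertwine [transferred] and [m], and of [transferred] to square to 0. *)
Lemma kernel_defect n w : ~~ nilp w -> (size w <= n)%N ->
    (forall u, ~~ nilp u -> (size u < n)%N ->
       \sum_(X <- ins tH transferred u) kernel X
       = \sum_(W <- wds kernel u) m W) ->
  \sum_(X <- ins tH transferred w) kernel_root X = - dA (kernel_root w).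
Proof.
move=> nw szw IH.
(* [m2] kills one-letter words, so the hypothesis on words shorter than [n] suffices for the
   exchange. *)
rewrite (@ins_wds_comm _ _ _ _ _ tA _ m _ kernel_t n) //; first last.
- by right.
- exact: m2_lin.
(* Splitting the outer [m] of its relation into unary part and [m2] evaluates the sum of [m2] over
   insertions. *)
rewrite (eq_big_wds _ (fun W => - dA (m W))); last first.
  move=> W nW _; move: (m_rel (nW nw)).
  rewrite (eq_big_ins _ (fun X => sing dA X + m2 X)) => [|X nX _]; last exact: mE.
  by rewrite big_split /= sum_sing_ins ?nW // addrC => /eqP; rewrite addr_eq0 => /eqP.
by rewrite sumrN -linear_sum sum_m_wds // linearD /= dA_sq add0r.
Qed.

Lemma sum_kernel_ins w : ~~ nilp w ->
  \sum_(X <- ins tH transferred w) kernel X = \sum_(W <- wds kernel w) m W.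
Proof.
have [n] := ubnP (size w); elim: n w => // n IHn w szw nw.
have D := kernel_defect nw szw (fun u nu szu => IHn u szu nu).
rewrite sum_m_wds //.
under eq_bigr => X _ do rewrite kernelE.
rewrite big_split sumrN /= sum_sing_ins // -linear_sum {}D.
rewrite kernelE /transferred !linearD !linearN /= opprK.
have <- : dA (sing i w) = i (sing dH w).
  by case: w {szw nw} => [|l [|l' w]]; rewrite /= ?linear0.
rewrite -!addrA; congr (_ + _).
(* What remains is the homotopy identity at [kernel_root w]. *)
rewrite -[X in _ = _ + X](subrK (i (p (kernel_root w)))) homotopy.
by rewrite addrA addKr addrC.
Qed.

(** [p] turns the defect [- dA (kernel_root w)] into [- dH (p (kernel_root w))], which cancels
    against the unary part of the outer operation. *)
Lemma transferred_rel w : ~~ nilp w ->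
  \sum_(X <- ins tH transferred w) transferred X = 0.
Proof.
move=> nw; rewrite big_split /= sum_sing_ins // -linear_sum.
rewrite (kernel_defect nw (leqnn _) (fun u nu _ => sum_kernel_ins nu)).
rewrite linearN /= p_d /transferred linearD /= addrK.
by case: w {nw} => [|l [|l' w]]; rewrite /= ?linear0.
Qed.

Lemma transferred1 l : transferred [:: l] = dH l.1.
Proof.
rewrite /transferred /kernel_root /= /wds /= big_cons big_nil /= !addr0.
by rewrite linear0 addr0.
Qed.

Lemma transferred2 l l' : transferred [:: l; l']
  = p (m [:: (i l.1, l.2); (i l'.1, l'.2)]).
Proof.
rewrite /transferred /kernel_root /wds /= !big_cons big_nil /= add0r !addr0.
rewrite !kernelE /kernel_root /wds /= !big_seq1 /= linear0 !subr0.
by rewrite /wt /= !addn0.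
Qed.

End Transfer.

(** * Gradings and suspension *)

Section Graded.
Variables (K : fieldType) (A : gradedSpace K).

Lemma homogD n (x y : A) : homog n x -> homog n y -> homog n (x + y).
Proof. by move=> hx hy; rewrite -[x]scale1r; apply: homog_lin. Qed.

Lemma homogZ n a (x : A) : homog n x -> homog n (a *: x).
Proof. by move=> hx; rewrite -[_ *: _]addr0; apply/homog_lin/homog0. Qed.

Lemma homogN n (x : A) : homog n x -> homog n (- x).
Proof. by rewrite -scaleN1r; apply: homogZ. Qed.

Lemma homog_span_ind (P : A -> Prop) : P 0 ->
    (forall x y, P x -> P y -> P (x + y)) ->
    (forall n x, homog n x -> P x) ->
  forall x, P x.
Proof.
move=> P0 PD Ph x; have [s [f [fh ->]]] := homog_span x.
elim: s => [|n s IHs]; first by rewrite big_nil.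
by rewrite big_cons; apply: PD => //; apply: Ph (fh n).
Qed.

Lemma homogs_cat ns (u v : seq A) : homogs ns (u ++ v) ->
  exists ns1 ns2, [/\ ns = ns1 ++ ns2, homogs ns1 u & homogs ns2 v].
Proof.
elim: u ns => [|x u IHu] [|n ns] //=; first by exists [::], [::].
  by exists [::], (n :: ns).
by case=> hx /IHu[ns1 [ns2 [-> h1 h2]]]; exists (n :: ns1), ns2.
Qed.

Lemma homogs_catr ns1 ns2 (u v : seq A) :
  homogs ns1 u -> homogs ns2 v -> homogs (ns1 ++ ns2) (u ++ v).
Proof.
by elim: u ns1 => [|x u IHu] [|n ns] //= [hx hu] hv; split; last exact: IHu.
Qed.

Lemma homogs_map (g : A -> A) ns xs : (forall n x, homog n x -> homog n (g x)) ->
  homogs ns xs -> homogs ns (map g xs).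
Proof. by move=> gh; elim: xs ns => [|x xs IHxs] [|n ns] //= [/gh hx /IHxs]. Qed.

Lemma size_homogs ns (xs : seq A) : homogs ns xs -> size ns = size xs.
Proof. by elim: xs ns => [|x xs IHxs] [|n ns] //= [_ /IHxs ->]. Qed.

(* Existence is only propositional since [homog_span] is a mere existence
   statement: the linear map is extracted by choice. *)
Lemma exists_diagonal (c : int -> K) :
  exists t : {linear A -> A}, forall n x, homog n x -> t x = c n *: x.
Proof.
(* [R] is the graph of the map, computed from any homogeneous decomposition; by linearity,
   single-valuedness only has to be checked over 0. *)
pose R x y := exists s : seq (int * A), [/\ forall q, q \in s -> homog q.1 q.2,
  x = \sum_(q <- s) q.2 & y = \sum_(q <- s) c q.1 *: q.2].
have R0 y : R 0 y -> y = 0.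
  case=> s [sh s0 ->].
  pose ds := undup [seq q.1 | q <- s].
  pose g n := \sum_(q <- s | q.1 == n) q.2.
  (* A decomposition may repeat degrees, whereas [homog_indep] asks for distinct ones, so terms are
     regrouped by degree. *)
  have part (F : int * A -> A) :
      \sum_(q <- s) F q = \sum_(n <- ds) \sum_(q <- s | q.1 == n) F q.
    under [RHS]eq_bigr => n _ do rewrite big_mkcond.
    rewrite exchange_big /=; apply: eq_big_seq => q qs.
    rewrite (bigD1_seq q.1) ?undup_uniq //=; last by rewrite mem_undup map_f.
    by rewrite eqxx big1 ?addr0 // => n; rewrite eq_sym => /negbTE ->.
  have gh n : homog n (g n).
    rewrite /g big_seq_cond; apply: big_ind; first exact: homog0.
      exact: homogD.
    by move=> q /andP[/sh hq /eqP <-].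
  have g0 n : n \in ds -> g n = 0.
    by apply: homog_indep (undup_uniq _) gh _ n; rewrite -part.
  rewrite part big_seq big1 // => n nds.
  transitivity (c n *: g n); last by rewrite g0 // scaler0.
  rewrite scaler_sumr.
  by apply: eq_bigr => q /eqP ->.
have Rl a x y x' y' : R x y -> R x' y' -> R (a *: x + x') (a *: y + y').
  move=> [s [sh -> ->]] [s' [sh' -> ->]].
  exists ([seq (q.1, a *: q.2) | q <- s] ++ s'); split.
  - by move=> q; rewrite mem_cat => /orP[/mapP[r /sh hr ->]|/sh' //]; apply: homogZ.
  - by rewrite big_cat big_map scaler_sumr.
  - rewrite big_cat big_map scaler_sumr; congr (_ + _).
    by apply: eq_bigr => q _; rewrite !scalerA mulrC.
have Rt x : exists y, R x y.
  apply: (homog_span_ind (P := fun x => exists y, R x y)).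
  - by exists 0, [::]; rewrite !big_nil.
  - move=> x1 x2 [y1 Ry1] [y2 Ry2]; exists (y1 + y2).
    by rewrite -[x1]scale1r -[y1]scale1r; apply: Rl.
  - move=> n z hz; exists (c n *: z), [:: (n, z)]; rewrite !big_seq1.
    by split=> // q; rewrite inE => /eqP ->.
have Ru x y y' : R x y -> R x y' -> y = y'.
  move=> Ry /(Rl (-1) _ _ _ _ Ry); rewrite scaleN1r addNr => /R0.
  by rewrite scaleN1r addrC => /subr0_eq.
pose t x := proj1_sig (constructive_indefinite_description _ (Rt x)).
have tR x : R x (t x) by rewrite /t; case: constructive_indefinite_description.
have tl : linear t by move=> a x y; apply: Ru (tR _) (Rl _ _ _ _ _ (tR x) (tR y)).
pose T := GRing.isLinear.Build K A A *:%R t tl.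
exists (HB.pack t T : {linear A -> A}) => n x hx; apply: Ru (tR x) _.
by exists [:: (n, x)]; rewrite !big_seq1; split=> // q; rewrite inE => /eqP ->.
Qed.

End Graded.

Lemma linear_homog_ext (K : fieldType) (A : gradedSpace K) (B : lmodType K)
    (f g : {linear A -> B}) : (forall n x, homog n x -> f x = g x) -> f =1 g.
Proof.
move=> fg; apply: homog_span_ind => [|x y fx fy|n x]; last exact: fg.
  by rewrite !linear0.
by rewrite !linearD fx fy.
Qed.

(** * Reduction to homogeneous arguments *)

Definition argwise_linear (K : fieldType) (A M : lmodType K) (F : seq A -> M) :=
  forall (a : K) us ws x y,
  F (us ++ (a *: x + y) :: ws) = a *: F (us ++ x :: ws) + F (us ++ y :: ws).

Section ArgwiseLinear.
Variables (K : fieldType) (A : gradedSpace K) (M : lmodType K).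
Variable F : seq A -> M.
Hypothesis F_lin : argwise_linear F.

Lemma argwise0 us ws : F (us ++ 0 :: ws) = 0.
Proof.
have := F_lin 1 us ws 0 0; rewrite !scale1r addr0.
by move/(congr1 (fun z => z - F (us ++ 0 :: ws))); rewrite subrr addrK.
Qed.

Lemma argwiseZ a us ws x : F (us ++ a *: x :: ws) = a *: F (us ++ x :: ws).
Proof. by rewrite -[a *: x]addr0 F_lin argwise0 addr0. Qed.

Lemma argwiseD us ws x y :
  F (us ++ (x + y) :: ws) = F (us ++ x :: ws) + F (us ++ y :: ws).
Proof. by rewrite -[x]scale1r F_lin !scale1r. Qed.

Lemma argwise_homog_eq0 :
    (forall ns xs, (0 < size xs)%N -> homogs ns xs -> F xs = 0) ->
  forall xs, (0 < size xs)%N -> F xs = 0.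
Proof.
move=> F0 xs xs_gt0.
(* Arguments are decomposed from left to right; [us] holds those already homogeneous. *)
suff H : forall ns us, homogs ns us -> (0 < size (us ++ xs))%N -> F (us ++ xs) = 0.
  exact: (H [::] [::]).
elim: xs {xs_gt0} => [|x xs IHxs] ns us hus gt0.
  by apply: F0 gt0 _; rewrite cats0; exact: hus.
elim/homog_span_ind: x gt0 => [|x y Fx Fy|n x hx] _; first exact: argwise0.
  by rewrite argwiseD Fx ?Fy ?size_cat ?addnS // addr0.
rewrite -cat_rcons; apply: (IHxs (rcons ns n)); last first.
  by rewrite size_cat size_rcons.
by rewrite -!cats1; apply: homogs_catr.
Qed.

End ArgwiseLinear.

(** * Suspension signs *)

Section Suspension.
Variables (K : fieldType).

Definition sg (z : int) : K := (-1) ^ z.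

Lemma sgD a b : sg (a + b) = sg a * sg b.
Proof. by rewrite /sg expfzDr // oppr_eq0 oner_eq0. Qed.

Lemma sg_eq a b c : a = b + 2 * c -> sg a = sg b.
Proof.
move=> ->; rewrite sgD [sg (2 * c)](_ : _ = 1) ?mulr1 //.
by rewrite /sg -exprz_exp -exprnP sqrrN expr1n exp1rz.
Qed.

(* The sign rule for the suspension [s]: [s x] has degree [n + 1]. *)
Definition parity_map (A : gradedSpace K) (t : A -> A) :=
  forall n x, homog n x -> t x = sg (n + 1) *: x.

(** The Koszul sign of removing one suspension from each argument: s x is passed once for every
    argument to its right, [k] of which lie beyond [xs]. As powers of [t], the sign needs no
    degrees. *)
Fixpoint desuspend (A : Type) (t : A -> A) (k : nat) (xs : seq A) : seq A :=
  if xs is x :: xs' then iter (size xs' + k) t x :: desuspend t k xs' else [::].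

Fixpoint susp_exp (k : nat) (ns : seq int) : int :=
  if ns is n :: ns' then (size ns' + k)%:Z * (n + 1) + susp_exp k ns' else 0.

Lemma susp_exp_cat k ns ns' :
  susp_exp k (ns ++ ns') = susp_exp (size ns' + k) ns + susp_exp k ns'.
Proof.
elim: ns => [|n ns IHns] /=; first by rewrite add0r.
by rewrite IHns size_cat addrA -addnA.
Qed.

Lemma susp_exp_shift k ns :
  susp_exp k ns = k%:Z * (\sum_(n <- ns) n + (size ns)%:Z) + susp_exp 0 ns.
Proof.
elim: ns => [|n ns IHns] /=; first by rewrite big_nil; ring.
by rewrite IHns big_cons addn0 PoszD -[(size ns).+1]addn1 PoszD; ring.
Qed.

Variables (A : gradedSpace K) (t : {linear A -> A}).
Hypothesis t_sg : parity_map t.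

Lemma sg_tK x : t (t x) = x.
Proof.
apply: (linear_homog_ext (f := t \o t) (g := idfun)) => {x} n x hx /=.
rewrite (t_sg hx) linearZ /= (t_sg hx) scalerA -sgD.
by rewrite (sg_eq (b := 0) (c := n + 1)) ?scale1r //; ring.
Qed.

Lemma homog_t n x : homog n x -> homog n (t x).
Proof. by move=> hx; rewrite (t_sg hx); apply: homogZ. Qed.

Lemma homog_iter_t k n x : homog n x -> homog n (iter k t x).
Proof. by elim: k => //= k IHk /IHk /homog_t. Qed.

Lemma iter_t k n x : homog n x -> iter k t x = sg (k%:Z * (n + 1)) *: x.
Proof.
move=> hx; elim: k => [|k IHk] /=; first by rewrite mul0r scale1r.
rewrite IHk linearZ /= (t_sg hx) scalerA -sgD; congr (sg _ *: x).
by rewrite -addn1 PoszD; ring.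
Qed.

Lemma desuspend_cat k u v :
  desuspend t k (u ++ v) = desuspend t (size v + k) u ++ desuspend t k v.
Proof. by elim: u => //= x u ->; rewrite size_cat addnA. Qed.

Lemma size_desuspend k xs : size (desuspend t k xs) = size xs.
Proof. by elim: xs => //= x xs ->. Qed.

Lemma desuspendK k : involutive (desuspend t k).
Proof.
elim=> //= x xs ->; rewrite size_desuspend; congr (_ :: _).
by elim: (_ + _)%N => // n IHn; rewrite iterSr iterS sg_tK.
Qed.

Lemma homogs_desuspend k ns xs : homogs ns xs -> homogs ns (desuspend t k xs).
Proof.
by elim: xs ns => [|x xs IHxs] [|n ns] //= [/homog_iter_t hx /IHxs].
Qed.

Lemma map_desuspend (B : Type) (g : A -> B) (t' : B -> B) k xs :
    (forall x, g (t x) = t' (g x)) ->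
  map g (desuspend t k xs) = desuspend t' k (map g xs).
Proof.
move=> gt; elim: xs => //= x xs ->; rewrite size_map; congr (_ :: _).
by elim: (_ + _)%N => //= n IHn; rewrite gt IHn.
Qed.

Lemma iter_linear (g : {linear A -> A}) n a x y :
  iter n g (a *: x + y) = a *: iter n g x + iter n g y.
Proof. by elim: n => //= n ->; rewrite linearP. Qed.

Variables (M : lmodType K) (F : seq A -> M).
Hypothesis F_lin : argwise_linear F.

Lemma argwise_desuspend k : argwise_linear (fun xs => F (desuspend t k xs)).
Proof.
by move=> a us ws x y; rewrite !desuspend_cat /= iter_linear F_lin.
Qed.

Lemma argwise_map_sg u v ns us : homogs ns us ->
  F (u ++ map t us ++ v)
  = sg (\sum_(n <- ns) n + (size ns)%:Z) *: F (u ++ us ++ v).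
Proof.
elim: us ns u => [|x us IHus] [|n ns] u //=.
  by rewrite big_nil scale1r.
case=> hx hus; rewrite (t_sg hx) argwiseZ // -cat_rcons (IHus ns) // scalerA.
rewrite -sgD cat_rcons; congr (sg _ *: _).
by rewrite big_cons -addn1 PoszD; ring.
Qed.

Lemma argwise_desuspend_sg k u v ns us : homogs ns us ->
  F (u ++ desuspend t k us ++ v) = sg (susp_exp k ns) *: F (u ++ us ++ v).
Proof.
elim: us ns u => [|x us IHus] [|n ns] u //=; first by rewrite scale1r.
case=> hx hus; rewrite (iter_t _ hx) argwiseZ // -cat_rcons (IHus ns) // scalerA.
by rewrite -sgD cat_rcons (size_homogs hus).
Qed.

End Suspension.

(** Turns a degree into the commutation rule with parity on which the ungraded transfer relies. *)
Lemma degree_parity (K : fieldType) (A B : gradedSpace K) (tA : {linear A -> A})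
    (tB : {linear B -> B}) k (g : {linear A -> B}) : parity_map tA -> parity_map tB ->
  has_degree k g -> forall x, g (tA x) = sg K k *: tB (g x).
Proof.
move=> sA sB gd; apply: homog_span_ind => [|x y gx gy|n x hx].
- by rewrite !linear0.
- by rewrite !linearD gx gy.
rewrite (sA _ _ hx) linearZ (sB _ _ (gd _ _ hx)) scalerA -sgD.
by congr (_ *: _); apply: (@sg_eq K _ _ (- k)); ring.
Qed.

Definition weightless (V : Type) (xs : seq V) : letters V :=
  [seq (x, 0%N) | x <- xs].

(** * Linearity and sliding for sums over insertions *)

Section Insertion.
Variables (K : fieldType) (U M : lmodType K) (t : {linear U -> U}).
Variable f : letters U -> U.
Implicit Types (g : letters U -> M).
Hypothesis f_lin : mlin f.

Lemma big_pre_split (T : Type) (N : zmodType) (F : seq T -> seq T -> N) u z w :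
  \sum_(q <- pre (u ++ z :: w)) F q.1 q.2
  = \sum_(q <- pre u) F q.1 (q.2 ++ z :: w)
    + (F (u ++ [:: z]) w + \sum_(q <- pre w) F (u ++ z :: q.1) q.2).
Proof. by rewrite big_pre_cat (big_pre_cons (fun a b => F (u ++ a) b)). Qed.

Lemma mlin_pre g : mlin g ->
  mlin (fun w => \sum_(q <- pre w) g ((f q.1, wt q.1) :: q.2)).
Proof.
move=> gl a u w x y c; pose F s r := g ((f s, wt s) :: r).
have step s r : F (u ++ (a *: x + y, c) :: s) r
    = a *: F (u ++ (x, c) :: s) r + F (u ++ (y, c) :: s) r.
  have wtE z : wt (u ++ (z, c) :: s) = wt (u ++ (0, c) :: s).
    by rewrite /wt !map_cat.
  by rewrite /F !wtE f_lin (gl a [::]).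
rewrite !(big_pre_split F) !scalerDr !scaler_sumr addrACA -big_split.
congr (_ + _).
  by apply: eq_bigr => q _; rewrite /F -cat_cons gl.
rewrite addrACA -big_split step; congr (_ + _).
by apply: eq_bigr => q _; rewrite step.
Qed.

Lemma mlin_ins g : mlin g -> mlin (fun w => \sum_(V <- ins t f w) g V).
Proof.
move=> gl a u; elim: u g gl => [|z u IHu] g gl w x y c; rewrite !big_ins.
  rewrite (mlin_pre gl a [::]) scalerDr addrACA; congr (_ + _).
  rewrite scaler_sumr -big_split; apply: eq_bigr => V _.
  by rewrite /lmap linearP /= (gl a [::]).
rewrite (mlin_pre gl a (z :: u)) (IHu _ (mlin_cons _ gl)).
by rewrite scalerDr addrACA.
Qed.

Variable al : {linear U -> U}.
Hypothesis f_al : forall w, ~~ nilp w -> f (map (lmap al) w) = al (f w).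
Hypothesis f_slides : slides al f f.
Hypothesis al_t : forall x, al (t x) = t (al x).

Lemma slides_pre g g' : slides al g g' ->
  slides al (fun w => \sum_(q <- pre w) g ((f q.1, wt q.1) :: q.2))
            (fun w => \sum_(q <- pre w) g' ((f q.1, wt q.1) :: q.2)).
Proof.
move=> gs u w x a; pose F g s r : M := g ((f s, wt s) :: r).
have step s r : F g (u ++ (x, a.+1) :: s) r
    = F g' (map (lmap al) u ++ (x, a) :: map (lmap al) s) (map (lmap al) r).
  have wtS : wt (u ++ (x, a.+1) :: s)
      = (wt (map (lmap al) u ++ (x, a) :: map (lmap al) s)).+1.
    rewrite /wt !map_cat /= !sumn_cat /= addnS /= -[in RHS]map_comp.
    by rewrite -map_comp addSn addnS.
  by rewrite /F wtS f_slides (gs [::]).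
rewrite (big_pre_split (F g)) (big_pre_split (F g')). rewrite !big_pre_map.
congr (_ + (_ + _)); last by apply: eq_bigr => q _; exact: step.
  apply: (eq_big_pre (g1 := fun s r => F g s (r ++ (x, a.+1) :: w))
    (g2 := fun s r => F g' (map (lmap al) s)
             (map (lmap al) r ++ (x, a) :: map (lmap al) w))) => s r _ ns.
  by rewrite /F -cat_cons gs /= wt_map f_al.
exact: (step [::]).
Qed.

Lemma slides_ins g g' : slides al g g' ->
  slides al (fun w => \sum_(V <- ins t f w) g V)
            (fun w => \sum_(V <- ins t f w) g' V).
Proof.
move=> gs u; elim: u g g' gs => [|z u IHu] g g' gs w x a; last first.
  rewrite !big_ins (slides_pre gs (z :: u)); congr (_ + _).
  apply: (IHu (fun V => g (lmap t z :: V))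
              (fun V => g' (lmap t (lmap al z) :: V))).
  by move=> u' w' y b; rewrite -cat_cons gs /= /lmap /= al_t.
rewrite !big_ins (slides_pre gs [::]); congr (_ + _).
rewrite [lmap t (x, a)]/lmap /=.
transitivity (\sum_(V <- ins t f w) g' ((t x, a) :: map (lmap al) V)).
  by apply: eq_bigr => V _; rewrite -[_ :: _]/([::] ++ _) gs.
(* Here the lowered letter lies outside the block, so [al] also hits the inserted value; it is
   carried inside the operation by [f_al]. *)
suff H (F : letters U -> M) : \sum_(V <- ins t f w) F (map (lmap al) V)
    = \sum_(V <- ins t f (map (lmap al) w)) F V.
  exact: (H (fun V => g' ((t x, a) :: V))).
elim: w F => [|y w IHw] F; first by rewrite !big_nil.
rewrite map_cons !big_ins -map_cons (big_pre_map (lmap al)); congr (_ + _).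
  apply: (eq_big_pre
    (g1 := fun r s => F (map (lmap al) ((f r, wt r) :: s)))
    (g2 := fun r s => F ((f (map (lmap al) r), wt (map (lmap al) r))
                          :: map (lmap al) s))) => r s _ nr.
  by rewrite f_al // wt_map.
rewrite -(IHw (fun V => F (lmap t (lmap al y) :: V))); apply: eq_bigr => V _.
by rewrite /= /lmap /= al_t.
Qed.

End Insertion.

Section WeightReduction.
Variables (V M : zmodType) (al : V -> V) (F : letters V -> M).
Hypothesis F_slides : slides al F F.

(** Each slide lowers the total weight by one, at the price of [al] on the other letters, so weights
    can be removed altogether. *)
Lemma weightless_eq0 :
    (forall xs, (0 < size xs)%N -> F (weightless xs) = 0) ->
  forall w, ~~ nilp w -> F w = 0.
Proof.
move=> F0 w; have [n] := ubnP (sumn [seq l.2 | l <- w]).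
elim: n w => // n IHn w; rewrite ltnS => wn nw.
have [w0 | ] := boolP (all (fun l => l.2 == 0%N) w).
  have -> : w = weightless [seq l.1 | l <- w].
    rewrite /weightless -map_comp -[LHS]map_id; apply/eq_in_map => -[x a] /=.
    by move/(allP w0) => /= /eqP ->.
  by apply: F0; rewrite size_map lt0n.
case/allPn => -[x [|a]] // /splitPr xw _; case: xw wn nw => u v wn _.
rewrite F_slides; apply: IHn; last by case: u {wn}.
apply: leq_trans wn; rewrite !map_cat !sumn_cat /= -!map_comp.
by rewrite addnS ltnS leqnn.
Qed.

(** The origin of the factors alpha^(s-1): the value of an s-ary operation on weightless letters has
    weight [k] = s - 1. *)
Lemma slides_iter xs y k ys :
  F (weightless xs ++ (y, k) :: weightless ys)
  = F (weightless (map (iter k al) xs ++ y :: map (iter k al) ys)).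
Proof.
rewrite /weightless map_cat /=.
elim: k xs ys => [|k IHk] xs ys; first by rewrite !map_id.
have E zs : map (lmap al) [seq (x, 0%N) | x <- zs] = [seq (x, 0%N) | x <- map al zs].
  by rewrite -!map_comp.
rewrite F_slides !E IHk -!map_comp.
by congr (F (_ ++ _ :: _)); apply: eq_map => z /=; rewrite -iterSr.
Qed.

End WeightReduction.

Lemma big_pre_take (T : Type) (M : zmodType) (F : seq T -> seq T -> M) w :
  \sum_(q <- pre w) F q.1 q.2
  = \sum_(1 <= s < (size w).+1) F (take s w) (drop s w).
Proof.
elim: w F => [|x w IHw] F; first by rewrite big_nil big_geq.
rewrite big_pre_cons (IHw (fun u => F (x :: u))) [RHS]big_nat_recl //=.
by rewrite take0 drop0.
Qed.

Lemma big_ins_take (U : Type) (M : zmodType) (t : U -> U) (f : letters U -> U)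
    (F : letters U -> M) w :
  \sum_(V <- ins t f w) F V
  = \sum_(0 <= r < size w) \sum_(1 <= s < (size w - r).+1)
      F (map (lmap t) (take r w)
         ++ (f (take s (drop r w)), wt (take s (drop r w))) :: drop (r + s) w).
Proof.
elim: w F => [|x w IHw] F; first by rewrite big_nil big_geq.
rewrite big_ins IHw [RHS]big_nat_recl //; congr (_ + _).
by rewrite (big_pre_take (fun u v => F ((f u, wt u) :: v))).
Qed.

(** * Suspended relations versus signed HA-infinity relations *)

Section Bridge.
Variables (K : fieldType) (A : gradedSpace K) (t al : {linear A -> A}).
Variables (mu : seq A -> A) (f : letters A -> A).
Hypothesis t_sg : parity_map t.
Hypothesis al_deg : has_degree 0 al.
Hypothesis mu_lin : multilinear mu.
Hypothesis mu_deg : forall (ns : seq int) (xs : seq A),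
  (0 < size xs)%N -> homogs ns xs ->
  homog (\sum_(n <- ns) n + (size xs)%:Z - 2) (mu xs).
Hypothesis f_slides : slides al f f.
Hypothesis fE : forall xs, f (weightless xs) = mu (desuspend t 0 xs).

Lemma degree0_homog n x : homog n x -> homog n (al x).
Proof. by move/al_deg; rewrite addr0. Qed.

Lemma degree0_parity x : al (t x) = t (al x).
Proof. by rewrite (degree_parity t_sg t_sg al_deg) scale1r. Qed.

Lemma wt_weightless (xs : seq A) : wt (weightless xs) = (size xs).-1.
Proof.
rewrite /wt /weightless -map_comp; congr _.-1.
by elim: xs => //= x xs ->.
Qed.

(** The outer sign depends only on the degrees of the whole word, not on the position of the block
    [v], so it factors out of the sum of all insertions. *)
Lemma ins_term_HA nu nv nz u v z : (0 < size v)%N ->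
    homogs nu u -> homogs nv v -> homogs nz z ->
  f (map (lmap t) (weightless u)
       ++ (f (weightless v), wt (weightless v)) :: weightless z)
  = sg K (susp_exp 0 (nu ++ nv ++ nz)) *:
    (sg K ((size u * size v + size z)%N%:Z
           + ((size v)%:Z - 2) * \sum_(n <- nu) n) *:
     mu (map (iter (size v).-1 al) u ++ mu v :: map (iter (size v).-1 al) z)).
Proof.
move=> v_gt0 hu hv hz.
have -> : map (lmap t) (weightless u) = weightless (map t u).
  by rewrite /weightless -!map_comp.
rewrite (slides_iter f_slides) fE wt_weightless fE.
set s := size v; set g := iter s.-1 al.
have g_hom n x : homog n x -> homog n (g x).
  by rewrite /g; elim: s.-1 => //= k IHk /IHk /degree0_homog.
have -> : map g (map t u) = map t (map g u).
  rewrite -!map_comp; apply: eq_map => x /=.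
  by rewrite /g; elim: s.-1 => //= k ->; rewrite degree0_parity.
have hy : homog (\sum_(n <- nv) n + s%:Z - 2) (mu (desuspend t 0 v)).
  have := mu_deg _ (homogs_desuspend t_sg 0 hv).
  by rewrite size_desuspend; apply.
have hL : homogs (nu ++ (\sum_(n <- nv) n + s%:Z - 2) :: nz)
    (map t (map g u) ++ mu (desuspend t 0 v) :: map g z).
  apply: homogs_catr; last by split=> //; apply: homogs_map.
  by apply/homogs_map/homogs_map => // n x; apply: homog_t.
have := argwise_desuspend_sg t_sg mu_lin 0 [::] [::] hL.
rewrite !cats0 /= => ->.
have := argwise_map_sg t_sg mu_lin [::] (mu (desuspend t 0 v) :: map g z)
  (homogs_map g_hom hu).
rewrite /= => ->.
have := argwise_desuspend_sg t_sg mu_lin 0 [::] [::] hv.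
rewrite !cats0 /= => ->.
rewrite argwiseZ // !scalerA -!sgD; congr (_ *: _).
rewrite !susp_exp_cat /= !addn0 !size_cat /=.
rewrite (susp_exp_shift (size nz).+1) (susp_exp_shift (size nv + size nz)).
rewrite (susp_exp_shift (size nz)).
rewrite (size_homogs hu) (size_homogs hv) (size_homogs hz) -/s.
(* The witness is half the difference of the exponents collected on the two sides. *)
apply: (@sg_eq K _ _ ((2 - s%:Z) * \sum_(n <- nu) n
  + (size u)%:Z - (size u)%:Z * s%:Z - (size z)%:Z)).
by rewrite -[(size z).+1]addn1 !PoszD PoszM; ring.
Qed.

(** Serves in both directions: from the given relations of [mu] to the suspended ones on A, and back
    from the suspended ones on H. *)
Lemma sum_ins_HA ns xs : homogs ns xs ->
  \sum_(V <- ins t f (weightless xs)) f V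
  = sg K (susp_exp 0 ns) *:
    \sum_(0 <= r < size xs) \sum_(1 <= s < (size xs - r).+1)
      (-1 : K) ^+ (r * s + (size xs - r - s)) *: HA_term mu al r s ns xs.
Proof.
move=> hxs; rewrite big_ins_take size_map scaler_sumr.
apply: eq_big_nat => r /andP[_ ltr]; rewrite scaler_sumr.
apply: eq_big_nat => s /andP[s_gt0]; rewrite ltnS => les.
have Dxs : xs = take r xs ++ take s (drop r xs) ++ drop (r + s) xs.
  by rewrite addnC -drop_drop !cat_take_drop.
have szu : size (take r xs) = r by rewrite size_takel // ltnW.
have szv : size (take s (drop r xs)) = s by rewrite size_takel // size_drop.
have := hxs; rewrite {1}Dxs => /homogs_cat[nu [nvz [Dns hu]]].
case/homogs_cat=> nv [nz [Dnvz hv hz]].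
rewrite /weightless -map_drop -!map_take -map_drop -/(weightless _).
rewrite -!/(weightless _) (ins_term_HA _ hu hv hz) ?szv // -Dnvz -Dns.
rewrite /HA_term szu size_drop subnDA.
have -> : take r ns = nu.
  by rewrite Dns take_size_cat // (size_homogs hu).
by rewrite sgD -scalerA.
Qed.

End Bridge.

(** * Degrees of the transferred operations *)

Section Degrees.
Variables (K : fieldType) (A H : gradedSpace K).

Lemma homog_eq (B : gradedSpace K) n n' (x : B) : homog n x -> n = n' -> homog n' x.
Proof. by move=> hx <-. Qed.

Lemma homog_big_pre (T : Type) (B : gradedSpace K) n (w : seq T)
    (F : seq T -> seq T -> B) :
    (forall u v, u ++ v = w -> ~~ nilp u -> homog n (F u v)) ->
  homog n (\sum_(q <- pre w) F q.1 q.2).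
Proof.
elim: w F => [|x w IHw] F Fh; first by rewrite big_nil; apply: homog0.
rewrite big_pre_cons; apply: homogD; first exact: Fh.
by apply: (IHw (fun u => F (x :: u))) => u v Duv _; apply: Fh; rewrite //= Duv.
Qed.

(** The sum of the degrees plus the length is the suspended degree of a word; [J] preserves it,
    hence so does collapsing blocks. *)
Lemma homog_big_wds (B : gradedSpace K) (J : letters H -> A) (g : letters A -> B) c :
    (forall ns w, ~~ nilp w -> homogs ns [seq l.1 | l <- w] ->
       homog (\sum_(n <- ns) n + (size w)%:Z - 1) (J w)) ->
    (forall ns w, homogs ns [seq l.1 | l <- w] ->
       homog (\sum_(n <- ns) n + (size w)%:Z + c) (g w)) ->
  forall ns w, homogs ns [seq l.1 | l <- w] ->
    homog (\sum_(n <- ns) n + (size w)%:Z + c) (\sum_(W <- wds J w) g W).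
Proof.
move=> Jh gh ns w; have [k] := ubnP (size w).
elim: k w ns g c gh => // k IHk [|x w] ns g c gh.
  by case: ns => // _ _; rewrite big_wds_nil; apply: (gh [::] [::]).
rewrite ltnS => szw hw; rewrite big_wds //.
apply: (homog_big_pre (F := fun u v => \sum_(W <- wds J v) g ((J u, wt u) :: W))).
move=> [|y u] v // Duv _; move: hw; rewrite -Duv map_cat.
case/homogs_cat=> nu [nv [-> hu hv]].
set d := \sum_(n <- nu) n + (size (y :: u))%:Z - 1.
(* The letter of the first block has suspended degree [d + 1], which the constant absorbs. *)
have := IHk v nv (fun W => g ((J (y :: u), wt (y :: u)) :: W)) (c + d + 1).
move=> IH; apply: homog_eq (IH _ _ hv) _.
- move=> ns' W hW; apply: homog_eq (gh (d :: ns') (_ :: W) _) _.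
    by split=> //; apply: Jh.
  by rewrite big_cons /= -[(size W).+1]addn1 PoszD /d; ring.
- by apply: leq_trans szw; rewrite -Duv /= size_cat ltnS leq_addl.
by rewrite big_cat /d size_cat PoszD /=; ring.
Qed.

Variables (dH : {linear H -> H}) (h : {linear A -> A}).
Variables (p : {linear A -> H}) (i : {linear H -> A}) (m : letters A -> A).
Hypothesis dH_deg : has_degree (-1) dH.
Hypothesis h_deg : has_degree 1 h.
Hypothesis p_deg : has_degree 0 p.
Hypothesis i_deg : has_degree 0 i.
Hypothesis m_deg : forall ns w, ~~ nilp w -> homogs ns [seq l.1 | l <- w] ->
  homog (\sum_(n <- ns) n + (size w)%:Z - 2) (m w).

Lemma homog_sing (B : gradedSpace K) (f : H -> B) c ns w : has_degree c f ->
    homogs ns [seq l.1 | l <- w] ->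
  homog (\sum_(n <- ns) n + (size w)%:Z + (c - 1)) (sing f w).
Proof.
move=> fd; case: w ns => [|l [|l' w]] ns hw; [exact: homog0| |exact: homog0].
case: ns hw => [|n [|n' ns]] //= [] // /fd hx _.
by apply: homog_eq hx _; rewrite big_seq1; ring.
Qed.

Lemma homog_m2 ns w : homogs ns [seq l.1 | l <- w] ->
  homog (\sum_(n <- ns) n + (size w)%:Z + (-2)) (m2 m w).
Proof.
by case: w => [|l [|l' w]] hw; [exact: homog0|exact: homog0|exact: m_deg].
Qed.

Lemma homog_kernel ns w : homogs ns [seq l.1 | l <- w] ->
  homog (\sum_(n <- ns) n + (size w)%:Z - 1) (kernel h i m w).
Proof.
rewrite /kernel; move: {2}(size w) => k.
elim: k ns w => [|k IHk] ns w hw /=; first exact: homog0.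
apply: homogD; first by apply: homog_eq (homog_sing i_deg hw) _; ring.
apply: homogN; apply: homog_eq (h_deg _) _.
  by apply: homog_big_wds hw; [move=> *; exact: IHk|exact: homog_m2].
by ring.
Qed.

Lemma homog_transferred ns w : homogs ns [seq l.1 | l <- w] ->
  homog (\sum_(n <- ns) n + (size w)%:Z - 2) (transferred h dH p i m w).
Proof.
move=> hw; apply: homogD; first by apply: homog_eq (homog_sing dH_deg hw) _; ring.
apply: homog_eq (p_deg _) _.
  apply: homog_big_wds hw; last exact: homog_m2.
  by move=> *; exact: homog_kernel.
by rewrite addr0.
Qed.

End Degrees.

(** * The rescaled, suspended operations on A *)

Section Desuspension.
Variables (K : fieldType) (A : gradedSpace K) (t al : {linear A -> A}).
Variable mu : seq A -> A.
Hypothesis t_sg : parity_map t.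
Hypothesis HA : HA_infinity mu al.

(** Common denominator: with total weight S, alpha^-a x is rewritten as alpha^-S applied to
    alpha^(S-a) x. *)
Definition level (w : letters A) : seq A :=
  [seq iter (sumn [seq l.2 | l <- w] - l.2) al l.1 | l <- w].

(* All signs of the [HA]-relations are absorbed in the suspension, and all
   powers of [alpha] in the weights of the letters. *)
Definition desuspended (w : letters A) : A := mu (desuspend t 0 (level w)).

Let al_t := degree0_parity t_sg (HA_alpha_degree HA).

Lemma level_map (g : A -> A) w : (forall x, al (g x) = g (al x)) ->
  level (map (lmap g) w) = map g (level w).
Proof.
move=> gal; rewrite /level -!map_comp; apply: eq_map => l /=.
by elim: (_ - _)%N => //= k ->.
Qed.

Lemma level_weightless xs : level (weightless xs) = xs.
Proof.
rewrite /level /weightless -!map_comp -[RHS]map_id; apply: eq_map => x /=.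
by rewrite subn0 (_ : sumn _ = 0%N) //; elim: xs.
Qed.

Lemma size_level w : size (level w) = size w.
Proof. exact: size_map. Qed.

Lemma desuspended_weightless xs :
  desuspended (weightless xs) = mu (desuspend t 0 xs).
Proof. by rewrite /desuspended level_weightless. Qed.

Lemma desuspended_lin : mlin desuspended.
Proof.
move=> a u w x y c; rewrite /desuspended /level !map_cat /= !sumn_cat /=.
by rewrite iter_linear (argwise_desuspend t (HA_multilinear HA)).
Qed.

Lemma desuspended_slides : slides al desuspended desuspended.
Proof.
move=> u w x a; congr (mu (desuspend t 0 _)); rewrite /level !map_cat /=.
have E v : [seq l.2 | l <- map (lmap al) v] = [seq l.2 | l <- v].
  by rewrite -map_comp.
rewrite !E !sumn_cat /= addSn addnS subSS -!map_comp.
(* Ensures that the truncated subtractions in [level] are exact. *)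
have le v l : l \in v -> (l.2 <= sumn [seq l.2 | l <- v])%N.
  elim: v => //= l' v IHv; rewrite inE => /orP[/eqP ->|/IHv lv]; first exact: leq_addr.
  exact: leq_trans lv (leq_addl _ _).
congr (_ ++ _ :: _); apply/eq_in_map => l /le ll /=; rewrite -iterSr subSn //.
  exact: leq_trans ll (leq_addr _ _).
exact: leq_trans ll (leq_trans (leq_addl _ _) (leq_addl _ _)).
Qed.

Lemma desuspended_al w : ~~ nilp w ->
  desuspended (map (lmap al) w) = al (desuspended w).
Proof.
move=> nw; rewrite /desuspended level_map // -(map_desuspend _ _ al_t).
by rewrite (HA_alpha_mu HA) // size_desuspend size_level lt0n.
Qed.

(** Suspending the value and the k arguments changes the degree of mu_k from k - 2 to (k - 2) + 1 -
    k = -1, which is odd. *)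
Lemma HA_operation_parity xs : (0 < size xs)%N -> mu (map t xs) = - t (mu xs).
Proof.
move=> xs_gt0; apply/eqP; rewrite -addr_eq0; apply/eqP; move: xs xs_gt0.
apply: (@argwise_homog_eq0 _ _ _ (fun xs => mu (map t xs) + t (mu xs))).
  move=> a us ws x y; rewrite !map_cat /= linearP (HA_multilinear HA).
  by rewrite (HA_multilinear HA) linearP scalerDr addrACA.
move=> ns xs xs_gt0 hxs.
have := argwise_map_sg t_sg (HA_multilinear HA) [::] [::] hxs.
rewrite /= !cats0 => ->; rewrite (t_sg (HA_degree HA xs_gt0 hxs)) -scalerDl.
rewrite (size_homogs hxs) -[RHS](scale0r (mu xs)); congr (_ *: _).
set D := (\sum_(n <- ns) n + _); rewrite (@sg_eq K (D - 2 + 1) (D + 1) (-1)); last by ring.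
by rewrite (sgD K D 1) [sg K 1](_ : _ = -1) ?mulrN1 ?subrr //; exact: expr1z.
Qed.

Lemma desuspended_t w : ~~ nilp w ->
  desuspended (map (lmap t) w) = - t (desuspended w).
Proof.
move=> nw; rewrite /desuspended level_map; last exact: al_t.
rewrite -(map_desuspend (t := t) (t' := t)) // HA_operation_parity //.
by rewrite size_desuspend size_level lt0n.
Qed.

Lemma desuspended1 l : desuspended [:: l] = mu [:: l.1].
Proof. by rewrite /desuspended /level /= addn0 subnn. Qed.

Lemma desuspended_deg ns w : ~~ nilp w -> homogs ns [seq l.1 | l <- w] ->
  homog (\sum_(n <- ns) n + (size w)%:Z - 2) (desuspended w).
Proof.
move=> nw hw; rewrite -(size_level w) -(size_desuspend t 0).
apply: (HA_degree HA); first by rewrite size_desuspend size_level lt0n.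
apply: homogs_desuspend => //; rewrite /level; move: (sumn _) hw => s.
elim: w ns {nw} => [|l w IHw] [|n ns] //= [hl /IHw hw]; split=> //.
by elim: (_ - _)%N => //= k; apply: degree0_homog (HA_alpha_degree HA) _ _.
Qed.

(** Sliding removes the weights and linearity makes the arguments homogeneous; what is left is the
    relation of [mu] up to a global sign. *)
Lemma desuspended_rel w : ~~ nilp w ->
  \sum_(V <- ins t desuspended w) desuspended V = 0.
Proof.
pose F w := \sum_(V <- ins t desuspended w) desuspended V.
apply: (@weightless_eq0 _ _ al F).
  apply: slides_ins desuspended_slides; last exact: al_t.
    exact: desuspended_al.
  exact: desuspended_slides.
apply: (@argwise_homog_eq0 _ _ _ (fun xs => F (weightless xs))).
  move=> a us ws x y; rewrite /weightless !map_cat /=.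
  have Fl : mlin F by apply: mlin_ins desuspended_lin _ desuspended_lin.
  exact: Fl.
move=> ns xs xs_gt0 hxs.
rewrite /F (sum_ins_HA t_sg (HA_alpha_degree HA) (HA_multilinear HA)
  (HA_degree HA) desuspended_slides desuspended_weightless hxs).
by rewrite (HA_relation HA xs_gt0 _ hxs) ?scaler0.
Qed.

End Desuspension.

Theorem theorem3p14 (K : fieldType) (charK : [pchar K] =i pred0)
    (A H : gradedSpace K) (dA : {linear A -> A}) (dH : {linear H -> H})
    (cA : chain_complex dA) (cH : chain_complex dH)
    (p : {linear A -> H}) (i : {linear H -> A}) (h : {linear A -> A})
    (contr : contraction dA dH p i h)
    (mu : seq A -> A) (alpha : {linear A -> A})
    (alpha_neq0 : exists x : A, alpha x <> 0)
    (HA : HA_infinity mu alpha)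
    (mu1 : forall x : A, mu [:: x] = dA x)
    (alpha_h : forall x : A, alpha (h x) = h (alpha x)) :
  exists muH : seq H -> H,
    [/\ HA_infinity muH (p \o alpha \o i),
        forall x : H, muH [:: x] = dH x
      & forall x y : H, muH [:: x; y] = p (mu [:: i x; i y])].
Proof.
have [[p_deg p_d] [i_deg i_d] h_deg hty pK] := contr.
have [dH_deg dH_sq] := cH.
have [tA tA_sg] := exists_diagonal A (fun n => sg K (n + 1)).
have [tH tH_sg] := exists_diagonal H (fun n => sg K (n + 1)).
have al_d x : alpha (dA x) = dA (alpha x).
  by rewrite -!mu1 (HA_alpha_mu HA).
have al_ip x : alpha (i (p x)) = i (p (alpha x)).
  have ipE y : i (p y) = y - (dA (h y) + h (dA y)) by rewrite -hty subKr.
  by rewrite !ipE linearB linearD /= al_d !alpha_h al_d.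
pose alH : {linear H -> H} := p \o alpha \o i.
have i_al y : i (alH y) = alpha (i y) by rewrite /= -al_ip pK.
have p_al x : p (alpha x) = alH (p x) by rewrite /= al_ip pK.
have dH_al y : dH (alH y) = alH (dH y) by rewrite /= -p_d -al_d i_d.
have alH_deg : has_degree 0 alH.
  move=> n x hx; have := p_deg _ _ (HA_alpha_degree HA (i_deg _ _ hx)).
  by rewrite !addr0.
have i_t y : i (tH y) = tA (i y) by rewrite (degree_parity tH_sg tA_sg i_deg) scale1r.
have h_t x : h (tA x) = - tA (h x).
  by rewrite (degree_parity tA_sg tA_sg h_deg) [sg K 1]expr1z scaleN1r.
pose m := desuspended tA alpha mu.
have m_lin : mlin m := desuspended_lin tA HA.
have m_slides : slides alpha m m := desuspended_slides tA alpha mu.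
have m_al := desuspended_al tA_sg HA.
have m_t := desuspended_t tA_sg HA.
have m_1 l : m [:: l] = dA l.1 by rewrite /m desuspended1 mu1.
have m_rel := desuspended_rel tA_sg HA.
have m_deg := desuspended_deg tA_sg HA.
pose nu := transferred h dH p i m.
have nu_slides : slides alH nu nu.
  by apply: (transferred_slides (alA := alpha)).
have nu_al w : nu (map (lmap alH) w) = alH (nu w).
  by apply: (transferred_al (alA := alpha)).
have nu_rel w : ~~ nilp w -> \sum_(V <- ins tH nu w) nu V = 0.
  by apply: (transferred_rel (tA := tA) (dA := dA)).
(* [desuspend] is involutive, so the map that introduced the suspension signs on A also removes them
   on H. *)
pose muH xs := nu (weightless (desuspend tH 0 xs)).
have muH_lin : multilinear muH.
  apply: (@argwise_desuspend _ _ tH _ (fun xs => nu (weightless xs))).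
  move=> a us ws x y; rewrite /weightless !map_cat /=.
  exact: transferred_lin.
have muH_deg (ns : seq int) (xs : seq H) : (0 < size xs)%N -> homogs ns xs ->
    homog (\sum_(n <- ns) n + (size xs)%:Z - 2) (muH xs).
  move=> _ hxs.
  rewrite -(size_desuspend tH 0) -(size_map (fun x => (x, 0%N))).
  apply: homog_transferred => //.
  by rewrite /weightless -map_comp map_id; apply: homogs_desuspend.
have nuE xs : nu (weightless xs) = muH (desuspend tH 0 xs).
  by rewrite /muH desuspendK.
exists muH; split.
- split=> //.
  + move=> xs xs_gt0; rewrite /muH -(map_desuspend _ _ (degree0_parity tH_sg alH_deg)).
    have -> ys : weightless (map alH ys) = map (lmap alH) (weightless ys).
      by rewrite /weightless -!map_comp.
    by rewrite nu_al.
  + move=> n ns xs + szxs hxs; rewrite -szxs => xs_gt0.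
    have := sum_ins_HA tH_sg alH_deg muH_lin muH_deg nu_slides nuE hxs.
    rewrite nu_rel; last by rewrite /nilp size_map -lt0n.
    move/esym/eqP; rewrite scaler_eq0 /sg expfz_eq0 oppr_eq0 oner_eq0 andbF.
    by move/eqP.
- by move=> x; rewrite /muH /nu /weightless /= transferred1.
- move=> x y; rewrite /muH /nu /weightless /= transferred2 /m /desuspended /level /=.
  (* The first argument receives parity twice, from H and from A; as [i] commutes with parity, the
     two cancel. *)
  by rewrite i_t (sg_tK tA_sg).
Qed.
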